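(* For every real $\gamma<2$ there exists a probability distribution $\mu$ on $\mathbb{R}$ such that, if $X$ and $Y$ are independent real random variables both with distribution $\mu$, then $$P(|X+Y|\le 1)>\gamma\cdot P(|X-Y|\le 1).$$ *)

(* Defs.v *)
From HB Require Import structures.
From mathcomp Require Import all_boot all_order all_algebra.
From mathcomp Require Import all_classical all_reals all_analysis.
Set Implicit Arguments.
Unset Strict Implicit.
Unset Printing Implicit Defensive.
Import Order.TTheory GRing.Theory Num.Theory.
Local Open Scope classical_set_scope.
Local Open Scope ring_scope.
Local Open Scope ereal_scope.

Definition independent_RV d (T : measurableType d) (R : realType)
    (P : probability T R) (X Y : {RV P >-> R}) : Prop :=
  forall A B : set R, measurable A -> measurable B ->
    P (X @^-1` A `&` Y @^-1` B) = P (X @^-1` A) * P (Y @^-1` B).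

(* Equality is only required on Borel sets: [distribution P X] and [mu] are
   total set functions whose values on non-Borel sets carry no meaning. *)
Definition has_distribution d (T : measurableType d) (R : realType)
    (P : probability T R) (X : {RV P >-> R})
    (mu : probability R R) : Prop :=
  forall A : set R, measurable A -> distribution P X A = mu A.

(* Main.v *)
Require Import Defs.
From HB Require Import structures.
From mathcomp Require Import all_boot all_order all_algebra.
From mathcomp Require Import all_classical all_reals all_analysis.
From mathcomp Require Import measurable_realfun zify lra.
Import Order.TTheory GRing.Theory Num.Theory.
Local Open Scope classical_set_scope.
Local Open Scope ring_scope.

(** Let [mu] be uniform on the [n] points [x_k = (-1)^k (k+1)], [0 <= k < n].
Two of these points on the same side of the origin differ by at least 2 unless
they coincide, and two on opposite sides differ by at least 3; so
[`|x_i - x_j| <= 1] exactly for the [n] diagonal pairs ([altptB_le1]).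
Changing the sign of one of the points interleaves the two sides: [x_i] and
[- x_j] are within distance 1 exactly when [i] and [j] are consecutive
([altptD_le1]), which gives [2 (n - 1)] ordered pairs.  All pairs of atoms have
the same probability [n^-2] under independence, so an event depending on
[(X, Y)] is measured by counting pairs ([prob_unif_pair]), and the ratio of the
two probabilities is [2 (n - 1) / n], which exceeds any [gamma < 2] for
large [n]. *)

(** * The alternating points and their close pairs *)

Definition altpt (R : realType) (k : nat) : R := (-1) ^+ k * k.+1%:R.

Lemma norm_altpt (R : realType) k : `|altpt R k| = k.+1%:R.
Proof. by rewrite /altpt normrM normrX normrN1 expr1n mul1r normr_nat. Qed.

Lemma altpt_inj (R : realType) : injective (altpt R).
Proof.
move=> i j /(congr1 Num.norm); rewrite !norm_altpt => /eqP.
by rewrite eqr_nat => /eqP [].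
Qed.

(** For [|i - j| <= 1] in the naturals, without a truncated difference. *)
Lemma near_nat (R : realType) i j :
  (`|i%:R - j%:R : R| <= 1) = (i <= j.+1)%N && (j <= i.+1)%N.
Proof.
rewrite ler_norml lerBlDl lerBrDl andbC -!(ler_nat R) -!natr1.
by congr (_ && _); apply/idP/idP => ?; lra.
Qed.

Lemma far_nat (R : realType) (i j : nat) : (`|i.+1%:R + j.+1%:R : R| <= 1) = false.
Proof. by rewrite -natrD normr_nat (ler_nat R _ 1) addSn addnS. Qed.

Lemma altptB_le1 (R : realType) i j :
  (`|altpt R i - altpt R j| <= 1) = (i == j).
Proof.
rewrite /altpt -(signr_odd _ i) -(signr_odd _ j).
case oi: (odd i); case oj: (odd j);
  rewrite !(expr0, expr1, mul1r, mulN1r, opprK, near_nat).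
- by rewrite addrC near_nat; lia.
- by rewrite -opprD normrN far_nat; lia.
- by rewrite far_nat; lia.
- by lia.
Qed.

Lemma altptD_le1 (R : realType) i j :
  (`|altpt R i + altpt R j| <= 1) = (i.+1 == j) || (j.+1 == i).
Proof.
rewrite /altpt -(signr_odd _ i) -(signr_odd _ j).
case oi: (odd i); case oj: (odd j);
  rewrite !(expr0, expr1, mul1r, mulN1r, opprK, near_nat).
- by rewrite -opprD normrN far_nat; lia.
- by rewrite addrC near_nat; lia.
- by lia.
- by rewrite far_nat; lia.
Qed.

(** * Counting close pairs *)

Lemma sum_eq_ord (n i : nat) :
  (\sum_(j < n) (i == j) = (i < n) :> nat)%N.
Proof.
elim: n => [|n IHn]; first by rewrite big_ord0.
by rewrite big_ord_recr /= IHn; lia.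
Qed.

Lemma sum_diag n : (\sum_(i < n) \sum_(j < n) (i == j :> nat) = n)%N.
Proof.
under eq_bigr => i _ do rewrite sum_eq_ord ltn_ord.
by rewrite sum1_card card_ord.
Qed.

(** The two orders [j = i + 1] and [i = j + 1] exclude each other and occur
equally often, [m] times each: the last index has no successor in range. *)
Lemma sum_neighbours m :
  (\sum_(i < m.+1) \sum_(j < m.+1) ((i.+1 == j :> nat) || (j.+1 == i :> nat))
     = m.*2)%N.
Proof.
have half : (\sum_(i < m.+1) \sum_(j < m.+1) (i.+1 == j :> nat) = m)%N.
  under eq_bigr => i _ do rewrite sum_eq_ord ltnS.
  rewrite big_ord_recr /= ltnn addn0.
  under eq_bigr => i _ do rewrite ltn_ord.
  by rewrite sum1_card card_ord.
have half' : (\sum_(i < m.+1) \sum_(j < m.+1) (j.+1 == i :> nat) = m)%N.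
  by rewrite exchange_big.
have orE (i j : nat) :
  ((i.+1 == j) || (j.+1 == i) = (i.+1 == j) + (j.+1 == i) :> nat)%N by lia.
under eq_bigr => i _.
  under eq_bigr => j _ do rewrite orE.
  rewrite big_split /=; over.
by rewrite big_split /= half half' addnn.
Qed.

(** * Uniform laws on finitely many points *)

(** Normalizing makes this a probability for every [n]; the Dirac mass is only
the value returned for the zero measure, when [n = 0]. *)
Definition unif_prob {R : realType} (x : nat -> R) (n : nat) : probability R R :=
  mnormalize (msum (fun k => \d_(x k)) n) (\d_(x 0%N)).

Lemma unif_prob_atom {R : realType} {x : nat -> R} {n i : nat} :
  injective x -> (i < n)%N -> unif_prob x n [set x i] = (n%:R^-1)%:E.
Proof.
move=> xI lt_in; pose nu : {measure set R -> \bar R} := msum (fun k => \d_(x k)) n.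
have nuT : nu setT = n%:R%:E.
  rewrite /nu /= /msum; under eq_bigr => k _ do rewrite /= /dirac indicT.
  by rewrite sumEFin sumr_const card_ord.
have nux : nu [set x i] = 1%:E.
  rewrite /nu /= /msum.
  under eq_bigr => k _ do rewrite /= diracE in_set1 (inj_eq xI) eq_sym.
  by rewrite sumEFin -natr_sum sum_eq_ord lt_in.
rewrite /unif_prob /= /mnormalize nuT /= eqe pnatr_eq0.
rewrite eqn0Ngt (leq_ltn_trans _ lt_in) //= [X in (X * _)%E]nux.
by rewrite -EFinM mul1r.
Qed.

Lemma prob_atom {R : realType} {x : nat -> R} {n : nat}
    {d : measure_display} {T : measurableType d} {P : probability T R}
    {X : {RV P >-> R}} (i : nat) :
  injective x -> has_distribution X (unif_prob x n) -> (i < n)%N ->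
  P (X @^-1` [set x i]) = (n%:R^-1)%:E.
Proof.
by move=> xI lawX lt_in; rewrite -(unif_prob_atom xI lt_in) -lawX.
Qed.

(** The [n] disjoint events [X = x_i] have total mass [n * n^-1 = 1], so that
they cover the whole space up to a null set. *)
Lemma total_probability_unif {R : realType} {x : nat -> R} {n : nat}
    {d : measure_display} {T : measurableType d} {P : probability T R}
    {X : {RV P >-> R}} (E : set T) :
  (0 < n)%N -> injective x -> has_distribution X (unif_prob x n) ->
  measurable E ->
  P E = (\sum_(i < n) P (E `&` X @^-1` [set x i]))%E.
Proof.
move=> n_gt0 xI lawX mE.
have mX i : measurable (X @^-1` [set x i]).
  by rewrite -[_ @^-1` _]setTI; exact: measurable_funP.
have additiveX F : measurable F ->
    P (\big[setU/set0]_(i < n) (F `&` X @^-1` [set x i])) =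
    (\sum_(i < n) P (F `&` X @^-1` [set x i]))%E.
  move=> mF; apply: (measure_bigsetU P (F := fun i => F `&` X @^-1` [set x i])).
    by move=> i; exact: measurableI.
  apply/trivIsetP => i j _ _ /eqP neq_ij; rewrite -subset0 => w /=.
  by move=> [[_ ->] [_ /xI]].
pose S := \big[setU/set0]_(i < n) (X @^-1` [set x i]).
have mS : measurable S by exact: bigsetU_measurable.
have PS : P S = 1%E.
  have := additiveX setT measurableT.
  under eq_bigr => i _ do rewrite setTI.
  under [in RHS]eq_bigr => i _.
    rewrite setTI (prob_atom _ xI lawX) //; over.
  move=> ->.
  rewrite sumEFin sumr_const card_ord -(mulr_natl n%:R^-1)  divff // pnatr_eq0.
  by rewrite -lt0n.
(* [S] has full measure, so the part of [E] outside it is negligible. *)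
have PSC : P (E `&` ~` S) = 0%E.
  apply: (subset_measure0 (B := ~` S)) => //.
  - by apply: measurableI => //; exact: measurableC.
  - exact: measurableC.
  - by have := probability_setC P mS; rewrite PS subee.
rewrite -additiveX // -big_distrr /= -/S.
rewrite -[in LHS](setIT E) -(setUv S) setIUr measureU //.
- by rewrite [X in (_ + X)%E]PSC adde0.
- exact: measurableI.
- by apply: measurableI => //; exact: measurableC.
- by rewrite setIACA setICr setI0.
Qed.

(** Conditioning on the values of [X] and then [Y] cuts the event into pieces
on which [r (X w) (Y w)] is constant: each piece is empty or a full rectangle
of probability [n^-2]. *)
Lemma prob_unif_pair {R : realType} {x : nat -> R} {n : nat}
    {d : measure_display} {T : measurableType d} {P : probability T R}
    {X Y : {RV P >-> R}} (r : R -> R -> bool) :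
  (0 < n)%N -> injective x -> independent_RV X Y ->
  has_distribution X (unif_prob x n) -> has_distribution Y (unif_prob x n) ->
  measurable [set w | r (X w) (Y w)] ->
  P [set w | r (X w) (Y w)] =
    ((\sum_(i < n) \sum_(j < n) r (x i) (x j))%N%:R / n%:R ^+ 2)%:E.
Proof.
move=> n_gt0 xI indXY lawX lawY mE.
have mX (Z : {RV P >-> R}) i : measurable (Z @^-1` [set x i]).
  by rewrite -[_ @^-1` _]setTI; exact: measurable_funP.
have mEX i := measurableI _ _ mE (mX X i).
rewrite (total_probability_unif _ n_gt0 xI lawX mE).
under eq_bigr => i _.
  rewrite (total_probability_unif _ n_gt0 xI lawY (mEX i)).
  under eq_bigr => j _.
    have -> : P ([set w | r (X w) (Y w)] `&` X @^-1` [set x i]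
        `&` Y @^-1` [set x j]) = ((r (x i) (x j))%:R / n%:R ^+ 2)%:E.
      case rij : (r (x i) (x j)).
        have -> : [set w | r (X w) (Y w)] `&` X @^-1` [set x i]
            `&` Y @^-1` [set x j] = X @^-1` [set x i] `&` Y @^-1` [set x j].
          by apply/seteqP; split=> w /= [] => [[_ ->] ->|-> ->]; rewrite ?rij.
        rewrite (indXY _ _ (measurable_set1 _) (measurable_set1 _)).
        by rewrite (prob_atom _ xI lawX) // (prob_atom _ xI lawY) // -EFinM mul1r expr2 invfM.
      rewrite mul0r (_ : _ `&` _ = set0) ?measure0 // -subset0 => w /=.
      by move=> [[+ Xw] Yw]; rewrite Xw Yw rij.
    over.
  rewrite sumEFin -mulr_suml -natr_sum; over.
by rewrite sumEFin -mulr_suml -natr_sum.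
Qed.

(** * Approaching the ratio 2 *)

Theorem mainTheorem3 (R : realType) (gamma : R) (hgamma : gamma < 2) :
  exists mu : probability R R,
    forall (d : measure_display) (T : measurableType d) (P : probability T R)
      (X Y : {RV P >-> R}),
      independent_RV X Y ->
      has_distribution X mu ->
      has_distribution Y mu ->
      (gamma%:E * P [set w | (`|X w - Y w| <= 1)%R]
         < P [set w | (`|X w + Y w| <= 1)%R])%E.
Proof.
(* With [m + 1] atoms the ratio is [2 m / (m + 1)], and it exceeds [gamma] as
   soon as [gamma < (2 - gamma) m]; [2 < (2 - gamma) m] suffices. *)
pose m := Num.bound (2 / (2 - gamma)).
have m_large : gamma * m.+1%:R < m.*2%:R.
  have d_gt0 : 0 < 2 - gamma by rewrite subr_gt0.
  have : 2 / (2 - gamma) < m%:R.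
    by rewrite archi_boundP // divr_ge0 // ltW.
  rewrite ltr_pdivrMr // -muln2 natrM -natr1 => ?; nra.
exists (unif_prob (altpt R) m.+1) => d T P X Y indXY lawX lawY.
have mnorm (f : T -> R) : measurable_fun setT f ->
    measurable [set w | (`|f w| <= 1)%R].
  move=> mf; rewrite -[X in measurable X]setTI.
  apply: (measurable_fun_ler (f := Num.norm \o f)
    (g := cst 1)) => //.
  exact: measurableT_comp.
rewrite (prob_unif_pair (fun u v => `|u - v| <= 1) _ (@altpt_inj R)
  indXY lawX lawY) //; last first.
  by apply: mnorm; exact: measurable_funB.
rewrite (prob_unif_pair (fun u v => `|u + v| <= 1) _ (@altpt_inj R)
  indXY lawX lawY) //; last first.
  by apply: mnorm; exact: measurable_funD.
under eq_bigr => i _ do under eq_bigr => j _ do rewrite altptB_le1.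
under [in ltRHS]eq_bigr => i _ do under eq_bigr => j _ do rewrite altptD_le1.
by rewrite sum_diag sum_neighbours -EFinM lte_fin mulrA ltr_pM2r //.
Qed.
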